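(* Assume that for all $t\in\{0,\dots,T\}$ every finite collection $\{X^\theta\}_{\theta\in\Theta}\subseteq\mathscr L_t(\mathbb R^d)$ admits a supremum with respect to $\preceq^t$. Then for every time $t=0,1,\dots,T-1$ and every state $S_t$ we have $$\mathcal V_t(S_t)\preccurlyeq^t\mathcal B_t(S_t),\quad\text{i.e. }\ \mathcal B_t(S_t)\subseteq\mathcal V_t(S_t)+\mathscr L_t(C),$$ as well as $$\mathcal V_t(S_t)\curlyeqprec^t\mathcal B_t(S_t),\quad\text{i.e. }\ \mathcal V_t(S_t)\subseteq\mathcal B_t(S_t)-\mathscr L_t(C).$$
   Context: Probabilistic setting. $(\Omega,\mathscr F)$ is a measurable space, $T\in\mathbb N$, $(\mathscr F_t)_{t=0,\dots,T}$ is the observation filtration, $\Theta\subset\mathbb R^d$ is a non-empty finite set, and $\{\mathbb Q_\theta:\theta\in\Theta\}$ is a family of probability measures on $(\Omega,\mathscr F)$, absolutely continuous with respect to a reference probability measure $\mathbb P$. $\mathbb E^\theta_t$ is the conditional expectation under $\mathbb Q_\theta$ given $\mathscr F_t$. All equalities, inequalities and inclusions are in the $\mathbb P$-a.s. sense. $\mathscr L_t(\mathbb R^d):=L^1(\Omega,\mathscr F_t,\mathbb P;\mathbb R^d)$. Conditional expectations $\mathbb E^\theta_t[X]$, $X\in\mathscr L_s(\mathbb R^d)$, $s\ge t$, are understood to be well-defined elements of $\mathscr L_t(\mathbb R^d)$, determined up to $\mathbb P$-null sets. Order. $\preceq$ is a fixed vector preorder on $\mathbb R^d$ (reflexive, transitive,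 and $x\preceq y$ implies $x+z\preceq y+z$ and $\alpha x\preceq\alpha y$ for $z\in\mathbb R^d$, $\alpha\ge0$), with ordering cone $C=\{x\in\mathbb R^d:0\preceq x\}$ (a convex cone containing $0$). $\mathscr L_t(C)\subseteq\mathscr L_t(\mathbb R^d)$ is the set of elements with values in $C$; for $X,Y\in\mathscr L_t(\mathbb R^d)$, $X\preceq^tY$ iff $Y-X\in\mathscr L_t(C)$. For sets $A,B\subseteq\mathscr L_t(\mathbb R^d)$: $A\preccurlyeq^tB$ iff $B\subseteq A+\mathscr L_t(C)$; $A\curlyeqprec^tB$ iff $A\subseteq B-\mathscr L_t(C)$ (Minkowski sums). Supremum. A supremum of $\{X^\theta\}_{\theta\in\Theta}\subseteq\mathscr L_t(\mathbb R^d)$ with respect to $\preceq^t$ is a $V\in\mathscr L_t(\mathbb R^d)$ such that (i) $X^\theta\preceq^tV$ for all $\theta\in\Theta$, and (ii) if $A\in\mathscr L_t(\mathbb R^d)$ satisfies $X^\theta\preceq^tA$ for all $\theta$, then $V\preceq^tA$. It need not be unique; $\operatorname{v-sup}^t_{\theta\in\Theta}X^\theta$ denotes one arbitrarily chosen supremum (the result holds for any choice). Control setting. $S_{t+1}=F(t,S_t,\varphi_t,Z_{t+1})$, $t=0,\dots,T-1$, $S_0=s$, where $S$ takes values in a measurable space $\mathbb S\subset\mathbb R^m$, $Z$ is an $\mathbb R^k$-valued random sequence, the controls $\varphi_t$ take values in a compact set $A$, and $F$ is measurable. Given the state $S_t$ at time $t$, $\mathfrak A_t(S_t)$ is the set of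 admissible one-step controls $\varphi_t$ and $\mathfrak A^t(S_t)$ is the set of admissible controls $\varphi=(\varphi_t,\dots,\varphi_{T-1})$ starting at time $t$; one has $(\varphi_t,\tilde\varphi)\in\mathfrak A^t(S_t)$ iff $\varphi_t\in\mathfrak A_t(S_t)$ and $\tilde\varphi\in\mathfrak A^{t+1}(F(t,S_t,\varphi_t,Z_{t+1}))$. $S^\varphi_T$ is the terminal state generated from $S_t$ by $\varphi$, and states $S_t$ are $\mathscr F_t$-measurable. $\ell:\mathbb S\to\mathbb R^d$ is a loss function, with $\ell(S^\varphi_T)\in\mathscr L_T(\mathbb R^d)$ for admissible $\varphi$. Value functions. $\mathcal V_T(S_T)=\mathcal B_T(S_T)=\{\ell(S_T)\}$ and, for $t=0,\dots,T-1$, $$\mathcal V_t(S_t)=\Big\{\operatorname{v-sup}^t_{\theta\in\Theta}\mathbb E^\theta_t[\ell(S^\varphi_T)]:\varphi\in\mathfrak A^t(S_t)\Big\},$$ and, recursively for $t=T-1,\dots,0$, $$\mathcal B_t(S_t)=\Big\{\operatorname{v-sup}^t_{\theta\in\Theta}\mathbb E^\theta_t[X]:\varphi_t\in\mathfrak A_t(S_t),\ X\in\mathcal B_{t+1}(F(t,S_t,\varphi_t,Z_{t+1}))\Big\}.$$ *)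

(* Defs.v *)
From HB Require Import structures.
From mathcomp Require Import all_boot all_order all_algebra.
From mathcomp Require Import all_classical all_reals all_analysis.
Import Order.TTheory GRing.Theory Num.Theory.
Import numFieldNormedType.Exports.

Set Implicit Arguments.
Unset Strict Implicit.
Unset Printing Implicit Defensive.

Local Open Scope classical_set_scope.
Local Open Scope ring_scope.

Section Probability.
Context {d0 : measure_display} {Omega : measurableType d0} {R : realType}.

(* [G] is a sub-sigma-algebra of [Omega], given as a set of events.  The Borel
   sigma-algebra of R^n is generated by the coordinates, so measurability of a
   random vector is measurability of its coordinates. *)
Definition rvec (n : nat) (G : set (set Omega)) (X : Omega -> 'rV[R]_n) :=
  forall i : 'I_n,
    measurable_fun [set: g_sigma_algebraType G] (fun w => X w ord0 i).

Definition filtration (T : nat) (Ft : nat -> set (set Omega)) :=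
  [/\ forall t, (t <= T)%N -> sigma_algebra [set: Omega] (Ft t),
      forall t, (t <= T)%N -> Ft t `<=` measurable
    & forall s t, (s <= t)%N -> (t <= T)%N -> Ft s `<=` Ft t].

Definition vintegrable (n : nat) (mu : {measure set Omega -> \bar R})
    (X : Omega -> 'rV[R]_n) :=
  forall i : 'I_n, mu.-integrable [set: Omega] (fun w => (X w ord0 i)%:E).

(* Random vectors are functions rather than classes modulo null sets. *)
Definition L1 (n : nat) (P : probability Omega R) (G : set (set Omega)) :
    set (Omega -> 'rV[R]_n) :=
  [set X | rvec G X /\ vintegrable P X].

Definition L1_in (n : nat) (P : probability Omega R) (G : set (set Omega))
    (C : set 'rV[R]_n) : set (Omega -> 'rV[R]_n) :=
  [set X | L1 P G X /\ \forall w \ae P, C (X w)].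

Definition is_condexp (n : nat) (Q : probability Omega R)
    (G : set (set Omega)) (X Y : Omega -> 'rV[R]_n) :=
  [/\ vintegrable Q X, rvec G Y, vintegrable Q Y
    & forall (i : 'I_n) (B : set Omega), G B ->
        (\int[Q]_(w in B) (Y w ord0 i)%:E = \int[Q]_(w in B) (X w ord0 i)%:E)%E].

Definition condexp (n : nat) (Q : probability Omega R) (G : set (set Omega))
    (X : Omega -> 'rV[R]_n) : Omega -> 'rV[R]_n :=
  xget (fun=> 0) [set Y | is_condexp Q G X Y].

(* A conditional expectation under [Q] is a priori unique only up to
   [Q]-null sets; uniqueness is required here up to [P]-null sets. *)
Definition condexp_well_defined (n T : nat) (Ft : nat -> set (set Omega))
    (P Q : probability Omega R) :=
  forall (t s : nat) (X : Omega -> 'rV[R]_n),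
    (t <= s)%N -> (s <= T)%N -> L1 P (Ft s) X ->
    (exists2 Y, L1 P (Ft t) Y & is_condexp Q (Ft t) X Y) /\
    (forall Y Y', is_condexp Q (Ft t) X Y -> is_condexp Q (Ft t) X Y' ->
       \forall w \ae P, Y w = Y' w).

End Probability.

Section Order.
Context {R : realType} {d : nat}.

Definition vector_preorder (le : 'rV[R]_d -> 'rV[R]_d -> Prop) :=
  [/\ forall x, le x x,
      forall x y z, le x y -> le y z -> le x z,
      forall x y z, le x y -> le (x + z) (y + z)
    & forall (a : R) x y, 0 <= a -> le x y -> le (a *: x) (a *: y)].

Definition ordering_cone (le : 'rV[R]_d -> 'rV[R]_d -> Prop) : set 'rV[R]_d :=
  [set x | le 0 x].

Context {d0 : measure_display} {Omega : measurableType d0}.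
Variables (P : probability Omega R) (le : 'rV[R]_d -> 'rV[R]_d -> Prop).
Variable (G : set (set Omega)).

Definition rle (X Y : Omega -> 'rV[R]_d) :=
  L1_in P G (ordering_cone le) (fun w => Y w - X w).

Definition is_vsup (I : Type) (X : I -> Omega -> 'rV[R]_d)
    (V : Omega -> 'rV[R]_d) :=
  [/\ L1 P G V,
      forall i, rle (X i) V
    & forall A, L1 P G A -> (forall i, rle (X i) A) -> rle V A].

Definition set_le_lower (A B : set (Omega -> 'rV[R]_d)) :=
  B `<=` [set (fun w => a w + c w) | a in A & c in L1_in P G (ordering_cone le)].

Definition set_le_upper (A B : set (Omega -> 'rV[R]_d)) :=
  A `<=` [set (fun w => b w - c w) | b in B & c in L1_in P G (ordering_cone le)].

End Order.

Definition borel (X : ptopologicalType) := g_sigma_algebraType (@open X).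

(* Joint measurability of a one-step map on SS x A x R^k equipped with the trace
   of the product of the Borel sigma-algebras; neither [SS] nor [A] has to be
   Borel, so [measurable_fun] on this domain could be vacuous. *)
Definition measurable_dynamics (R : realType) (m k : nat)
    (U : ptopologicalType) (SS : set 'rV[R]_m) (A : set U)
    (f : 'rV[R]_m -> U -> 'rV[R]_k -> 'rV[R]_m) :=
  forall B : set (borel 'rV[R]_m), measurable B ->
    exists2 E : set (borel 'rV[R]_m * borel U * borel 'rV[R]_k), measurable E
      & forall x u z, SS x -> A u -> (B (f x u z) <-> E (x, u, z)).

Section Control.
Context {R : realType} {d m k : nat} {d0 : measure_display}
  {Omega : measurableType d0} {U : ptopologicalType}.
Variables (T : nat) (Ft : nat -> set (set Omega)).
Variables (Theta : set 'rV[R]_d) (Q : Theta -> probability Omega R).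
Variable (vsup : nat -> (Theta -> Omega -> 'rV[R]_d) -> Omega -> 'rV[R]_d).
Variable (F : nat -> 'rV[R]_m -> U -> 'rV[R]_k -> 'rV[R]_m).
Variable (Z : nat -> Omega -> 'rV[R]_k).
Variable (adm1 : nat -> (Omega -> 'rV[R]_m) -> set (Omega -> U)).
Variable (ell : 'rV[R]_m -> 'rV[R]_d).

Definition is_state (SS : set 'rV[R]_m) (t : nat) (S : Omega -> 'rV[R]_m) :=
  (forall w, SS (S w)) /\ rvec (Ft t) S.

Definition next_state (t : nat) (S : Omega -> 'rV[R]_m) (u : Omega -> U) :
    Omega -> 'rV[R]_m :=
  fun w => F t (S w) (u w) (Z t.+1 w).

(* A control starting at time [t] is the list [:: phi_t; ...; phi_(T-1)];
   at time [T] the only one is the empty list. *)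
Fixpoint adm (t : nat) (S : Omega -> 'rV[R]_m) (phi : seq (Omega -> U)) : Prop :=
  if phi is u :: phi' then
    [/\ (t < T)%N, adm1 t S u & adm t.+1 (next_state t S u) phi']
  else t = T.

Fixpoint terminal (t : nat) (S : Omega -> 'rV[R]_m) (phi : seq (Omega -> U)) :
    Omega -> 'rV[R]_m :=
  if phi is u :: phi' then terminal t.+1 (next_state t S u) phi' else S.

Definition vsup_condexp (t : nat) (X : Omega -> 'rV[R]_d) : Omega -> 'rV[R]_d :=
  vsup t (fun theta => condexp (Q theta) (Ft t) X).

Definition value (t : nat) (S : Omega -> 'rV[R]_m) : set (Omega -> 'rV[R]_d) :=
  if (t < T)%N then
    [set vsup_condexp t (ell \o terminal t S phi) | phi in [set phi | adm t S phi]]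
  else [set ell \o S].

(* [n] is the number of remaining steps. *)
Fixpoint bellman_rec (n t : nat) (S : Omega -> 'rV[R]_m) :
    set (Omega -> 'rV[R]_d) :=
  if n is n'.+1 then
    [set V | exists u X, [/\ adm1 t S u,
       bellman_rec n' t.+1 (next_state t S u) X & V = vsup_condexp t X]]
  else [set ell \o S].

Definition bellman (t : nat) (S : Omega -> 'rV[R]_m) : set (Omega -> 'rV[R]_d) :=
  bellman_rec (T - t) t S.

End Control.

(* Main.v *)
Require Import Defs.
From HB Require Import structures.
From mathcomp Require Import all_boot all_order all_algebra.
From mathcomp Require Import all_classical all_reals all_analysis.
From mathcomp Require Import measurable_realfun ring zify.
Import Order.TTheory GRing.Theory Num.Theory.
Import numFieldNormedType.Exports.

(** The value at time [t] of a control is a least upper bound, over the models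
    [theta], of the conditional expected losses.  Both inclusions therefore
    follow from one correspondence: every element [X] of the Bellman set is,
    for some admissible control, an upper bound at time [t] of the expected
    losses under all models, and every admissible control has such an [X].  The
    correspondence is proved backwards in time ([bellman_rec_dominates],
    [control_dominated]).  If [X] dominates the losses expected at time [t.+1],
    then by monotonicity of conditional expectations and the tower property its
    conditional expectation under [theta] dominates the loss expected at time
    [t], and the supremum over the models dominates all of these
    ([dominates_step]).

    The delicate point is the monotonicity of conditional expectations: if [D]
    takes its values in the ordering cone [C], so should [E(D | G)].  The cone
    need be neither closed nor Borel, and for a general convex cone in
    dimension three this fails: let [C] be generated by an open disc and a
    non-measurable set of points of its boundary circle, and let [D] be either
    zero or on a random extreme ray; then [E(D | G)] may be outside [C] on a set
    that is not negligible.  The existence of suprema of random vectors has to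
    be used.

    - For a total cone [K] (one with [x] or [-x] in [K] for every [x])
      monotonicity always holds ([total_cone_stable]), since a total cone has a
      lexicographic description by linear functionals, which can be peeled off
      one by one ([total_cone_functional]).  It passes to finite intersections,
      but not to infinite ones, because of the exceptional null sets.
    - Every convex cone is an intersection of total cones, by Zorn's lemma
      ([total_cone_separation]).  This is enough for deterministic means, which
      involve no null set: the mean of a random vector with values in a convex
      cone belongs to the cone ([mean_in_cone]).
    - If there are two different models, then for every vector [x] there is a
      random supremum of [x] and [0]; its mean is a deterministic supremum
      ([vsup_pospart]).  So [C] is the positive cone of a finite-dimensional
      vector lattice, and such a cone is a finite intersection of total cones,
      one for each member of a maximal disjoint system of positive vectors
      ([lattice_cone_inter]).
    - If there is only one model, a supremum differs from the unique member of
      the family by an element of [C] and of [-C], and it is enough that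
      conditional expectations preserve the linear space of such vectors,
      which is the intersection of two opposite total cones
      ([total_cone_extension]).

    Conditional expectations under [Q theta] are compared outside [Q theta]-null
    events, whereas the order is meant outside [P]-null ones.  The assumed
    [P]-almost sure uniqueness of conditional expectations implies that
    the two notions agree on observable events ([observable_null]). *)

Set Implicit Arguments.
Unset Strict Implicit.
Unset Printing Implicit Defensive.

Local Open Scope classical_set_scope.
Local Open Scope ring_scope.

Ltac row_ring := by apply/rowP => ?; rewrite !mxE; ring.

(** * Convex cones and total cones *)

Definition is_cone (R : realType) n (K : set 'rV[R]_n) :=
  [/\ K 0, forall x y, K x -> K y -> K (x + y)
    & forall a x, 0 <= a -> K x -> K (a *: x)].

Definition total_cone (R : realType) n (K : set 'rV[R]_n) :=
  is_cone K /\ forall x, K x \/ K (- x).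

Section Cones.
Context {R : realType} {n : nat}.
Implicit Types (x y : 'rV[R]_n) (K C : set 'rV[R]_n).

Lemma vector_preorder_cone (le : 'rV[R]_n -> 'rV[R]_n -> Prop) :
  vector_preorder le -> is_cone (ordering_cone le).
Proof.
move=> [refl trans addr scale]; split; first exact: refl.
- move=> x y x0 y0; apply: (trans _ _ _ y0).
  by have := addr _ _ y x0; rewrite add0r.
- by move=> a x a0 x0; have := scale _ _ _ a0 x0; rewrite scaler0.
Qed.

Lemma cone_preimage p (M : 'M[R]_(p, n)) K :
  is_cone K -> is_cone [set y | K (y *m M)].
Proof.
move=> [K0 KD KZ]; split => /=; first by rewrite mul0mx.
- by move=> x y; rewrite mulmxDl; apply: KD.
- by move=> a x a0; rewrite -scalemxAl; apply: KZ.
Qed.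

Lemma total_cone_preimage p (M : 'M[R]_(p, n)) K :
  total_cone K -> total_cone [set y | K (y *m M)].
Proof.
move=> [Kc Kt]; split; first exact: cone_preimage.
by move=> x /=; rewrite mulNmx; apply: Kt.
Qed.

Lemma cone_inter (I : Type) (K : I -> set 'rV[R]_n) :
  (forall i, is_cone (K i)) -> is_cone [set x | forall i, K i x].
Proof.
move=> Kc; split => /=.
- by move=> i; case: (Kc i).
- by move=> x y Kx Ky i; case: (Kc i) => _ + _; apply.
- by move=> a x a0 Kx i; case: (Kc i) => _ _; apply.
Qed.

Lemma cone_opp K : is_cone K -> is_cone [set x | K (- x)].
Proof.
move=> [K0 KD KZ]; split => /=; first by rewrite oppr0.
- by move=> x y; rewrite opprD; apply: KD.
- by move=> a x a0; rewrite -scalerN; apply: KZ.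
Qed.

(** For the order of [K], the vector [x] is infinitely close to [v *: e]
    compared with [e].  As a relation between [x] and [v] this is visibly
    linear; for an order unit [e] of a total cone it is the graph of a
    functional. *)
Definition cut K (e x : 'rV[R]_n) (v : R) :=
  forall eps, 0 < eps -> K (x - (v - eps) *: e) /\ K ((v + eps) *: e - x).

Lemma cut_lin K e x y v w a : is_cone K ->
  cut K e x v -> cut K e y w -> cut K e (a *: x + y) (a * v + w).
Proof.
move=> [K0 KD KZ] cx cy eps eps0.
pose del := eps / (`|a| + 1).
have a1 : 0 < `|a| + 1 by rewrite ltr_wpDl.
have del0 : 0 < del by rewrite divr_gt0.
have epsE : eps = `|a| * del + del by rewrite /del; field; rewrite gt_eqF.
have [x1 x2] := cx _ del0; have [y1 y2] := cy _ del0.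
have [a0|a0] := leP 0 a.
  rewrite epsE ger0_norm//; split.
  - by have := KD _ _ (KZ _ _ a0 x1) y1; congr (K _); row_ring.
  - by have := KD _ _ (KZ _ _ a0 x2) y2; congr (K _); row_ring.
have {}a0 : 0 <= - a by rewrite oppr_ge0 ltW.
rewrite epsE -normrN ger0_norm//; split.
- by have := KD _ _ (KZ _ _ a0 x2) y1; congr (K _); row_ring.
- by have := KD _ _ (KZ _ _ a0 x1) y2; congr (K _); row_ring.
Qed.

(** A supporting hyperplane.  The order unit [e] is a sum of signed basis
    vectors lying in [K], and [f x = sup {r | r *: e <= x}] is linear because
    totality turns this supremum into the infimum of [{r | x <= r *: e}]. *)
Lemma total_cone_functional K : total_cone K -> ~ (forall x, K x) ->
  exists (c : 'cV[R]_n) (e : 'rV[R]_n),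
    (e *m c) 0 0 = 1 /\ forall x, K x -> 0 <= (x *m c) 0 0.
Proof.
move=> [[K0 KD KZ] Kt] Knt; have Kc : is_cone K by split.
have /choice[a aP] : forall i : 'I_n, exists a : 'rV[R]_n, K a /\
    forall r : R, K (`|r| *: a - r *: delta_mx 0 i).
  move=> i; have [Kd|Kd] := Kt (delta_mx 0 i).
    exists (delta_mx 0 i); split => // r.
    by rewrite -scalerBl; apply: KZ => //; rewrite subr_ge0 ler_norm.
  exists (- delta_mx 0 i); split => // r.
  rewrite scalerN -opprD -scalerDl -scalerN; apply: KZ => //.
  by rewrite -lerBlDr sub0r -normrN ler_norm.
pose e := \sum_i a i.
have KS (I : Type) (s : seq I) (Pr : pred I) (F : I -> 'rV[R]_n) :
    (forall i, Pr i -> K (F i)) -> K (\sum_(i <- s | Pr i) F i).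
  by move=> KF; apply: (big_ind K).
have Kee : K e by apply: (KS) => i _; exact: (aP i).1.
have Ke x : exists2 r : R, 0 <= r & K (r *: e - x).
  exists (\sum_i `|x 0 i|); first exact: sumr_ge0.
  rewrite {2}(row_sum_delta x) scaler_suml -sumrB; apply: (KS) => i _.
  have -> : `|x 0 i| *: e = `|x 0 i| *: a i + `|x 0 i| *: \sum_(j | j != i) a j.
    by rewrite -scalerDr /e (bigD1 i).
  rewrite addrAC; apply: KD; first exact: (aP i).2.
  by apply: KZ => //; apply: (KS) => j _; exact: (aP j).1.
have KNe : ~ K (- e).
  move=> KN; apply: Knt => x; have [r r0] := Ke (- x); rewrite opprK => Kx.
  have := KD _ _ Kx (KZ _ _ r0 KN).
  by congr (K _); row_ring.
have KNr r : r < 0 -> ~ K (r *: e).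
  move=> r0 Kr; apply: KNe.
  have r1 : 0 <= (- r)^-1 by rewrite invr_ge0 oppr_ge0 ltW.
  have := KZ _ _ r1 Kr; rewrite scalerA invrN mulNr mulVf ?lt_eqF//.
  by rewrite scaleN1r.
have cut_ex x : exists v, cut K e x v.
  pose A := [set r : R | K (x - r *: e)].
  have [r1 r10 Kr1] := Ke x; have [r2 r20 Kr2] := Ke (- x).
  have A0 : A (- r2) by rewrite /A /= scaleNr opprK addrC -[x]opprK.
  have Aub r : A r -> r <= r1.
    rewrite /A /= => Ar; rewrite leNgt; apply/negP => r1r.
    apply: (@KNr (r1 - r)); first by rewrite subr_lt0.
    by have := KD _ _ Kr1 Ar; congr (K _); row_ring.
  have Asup : has_sup A by split; [exists (- r2) | exists r1 => r; exact: Aub].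
  exists (sup A) => eps eps0; split.
    have [r Ar supr] := sup_adherent eps0 Asup.
    have r0 : 0 <= r - (sup A - eps) by rewrite subr_ge0 ltW.
    by have := KD _ _ Ar (KZ _ _ r0 Kee); congr (K _); row_ring.
  have [Kx|] := Kt (x - (sup A + eps) *: e); last by rewrite opprB.
  have : sup A + eps <= sup A by apply: ub_le_sup => //; case: Asup.
  by rewrite gerDl leNgt eps0.
have cut_uniq x v w : cut K e x v -> cut K e x w -> v <= w.
  move=> cv cw; rewrite leNgt; apply/negP => wv.
  have eps0 : 0 < (v - w) / 3 by rewrite divr_gt0// subr_gt0.
  have [+ _] := cv _ eps0; have [_ +] := cw _ eps0 => h1 h2.
  apply: (@KNr ((w - v) / 3)); first by rewrite pmulr_llt0// subr_lt0.
  by have := KD _ _ h1 h2; congr (K _); apply/rowP => ?; rewrite !mxE; field.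
have /choice[c0 c0P] := fun i : 'I_n => cut_ex (delta_mx 0 i).
pose c : 'cV[R]_n := \col_i c0 i.
have cut0 : cut K e 0 0.
  move=> eps eps0.
  by split; have := KZ _ _ (ltW eps0) Kee; congr (K _); row_ring.
have cutc x : cut K e x ((x *m c) 0 0).
  rewrite {1}(row_sum_delta x) mxE.
  elim/big_rec2 : _ => // i v y _ cy; rewrite !mxE.
  exact: cut_lin.
have cute : cut K e e 1.
  move=> eps eps0.
  by split; have := KZ _ _ (ltW eps0) Kee; congr (K _); row_ring.
exists c, e; split.
  by apply/eqP; rewrite eq_le !(@cut_uniq e)//.
move=> x Kx; rewrite leNgt; apply/negP => x0.
have eps0 : 0 < - (x *m c) 0 0 / 2 by rewrite divr_gt0// oppr_gt0.
have [_ +] := cutc x _ eps0 => h.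
apply: (@KNr ((x *m c) 0 0 / 2)); first by rewrite pmulr_llt0.
by have := KD _ _ Kx h; congr (K _); apply/rowP => ?; rewrite !mxE; field.
Qed.

(** Szpilrajn's extension, keeping the lineality space: in a maximal cone with
    the same lineality space, a vector [y] such that neither [y] nor [-y]
    belongs to it could still be adjoined. *)
Lemma total_cone_extension C : is_cone C ->
  exists K, [/\ total_cone K, C `<=` K & forall x, K x -> K (- x) -> C x].
Proof.
move=> Cc.
pose good K := [/\ is_cone K, C `<=` K & forall x, K x -> K (- x) -> C x].
have goodC : good C by split.
(* The disjunct [set0] accommodates the union of the empty chain. *)
have [] := @Zorn_bigcup _ (fun K => K = set0 \/ good K).
  move=> F FP Ftot.
  have [[K0 [FK0 gK0]]|nex] := pselect (exists K, F K /\ good K); last first.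
    left; apply/seteqP; split => // x [K FK Kx].
    by have [K0|gK] := FP _ FK; [rewrite K0 in Kx | apply: nex; exists K].
  right.
  have good_of K x : F K -> K x -> good K.
    by move=> FK Kx; have [K0'|//] := FP _ FK; rewrite K0' in Kx.
  have both x y : (\bigcup_(X in F) X) x -> (\bigcup_(X in F) X) y ->
      exists K, [/\ F K, K x, K y & good K].
    move=> [K1 FK1 K1x] [K2 FK2 K2y].
    have [K12|K21] := Ftot _ _ FK1 FK2.
      by exists K2; split => //; [apply: K12|apply: good_of K2y].
    by exists K1; split => //; [apply: K21|apply: good_of K1x].
  split; first split.
  - by exists K0 => //; case: gK0 => - [].
  - move=> x y xF yF; have [K [FK Kx Ky [[_ KD _] _ _]]] := both _ _ xF yF.
    by exists K => //; apply: KD.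
  - move=> a x a0 [K FK Kx]; have [[_ _ KZ] _ _] := good_of _ _ FK Kx.
    by exists K => //; apply: KZ.
  - by move=> x Cx; exists K0 => //; case: gK0 => _ + _; apply.
  - move=> x xF yF; have [K [FK Kx Ky [_ _]]] := both _ _ xF yF.
    exact.
move=> K [[K0|gK] Kmax].
  exfalso; apply: (Kmax C); last by right.
  rewrite K0; split; first exact: sub0set.
  by case: Cc => C0 _ _ /(_ 0 C0).
case: gK => -[K0 KD KZ] CK Klin; exists K; split => //; split => // y.
apply: contrapT => /not_orP[Ky KNy].
pose K' := [set z | exists k (t : R), [/\ K k, 0 <= t & z = k + t *: y]].
apply: (Kmax K'); first split.
- by move=> x Kx; exists x, 0; rewrite scale0r addr0.
- move=> /(_ y) K'y; apply: Ky; apply: K'y.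
  by exists 0, 1; rewrite scale1r add0r.
right; split; first split.
- by exists 0, 0; rewrite scale0r addr0.
- move=> _ _ [k [t [Kk t0 ->]]] [k' [t' [Kk' t'0 ->]]].
  exists (k + k'), (t + t'); split; [exact: KD|exact: addr_ge0|].
  by rewrite scalerDl addrACA.
- move=> a _ a0 [k [t [Kk t0 ->]]]; exists (a *: k), (a * t).
  by split; [exact: KZ|exact: mulr_ge0|rewrite scalerDr scalerA].
- by move=> x /CK Kx; exists x, 0; rewrite scale0r addr0.
move=> x [k [t [Kk t0 xE]]] [k' [t' [Kk' t'0 xE']]].
have sum0 : k + k' + (t + t') *: y = 0.
  by rewrite scalerDl addrACA -xE -xE' subrr.
have [tt0|tt0] := eqVneq (t + t') 0.
  have t00 : t = 0 by apply/eqP; move/eqP: tt0; rewrite paddr_eq0// => /andP[].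
  have t'00 : t' = 0 by rewrite t00 add0r in tt0.
  apply: Klin; first by rewrite xE t00 scale0r addr0.
  by rewrite xE' t'00 scale0r addr0.
exfalso; apply: KNy.
have tt1 : 0 <= (t + t')^-1 by rewrite invr_ge0 addr_ge0.
have := KZ _ _ tt1 (KD _ _ Kk Kk'); congr (K _).
move/eqP: sum0; rewrite addr_eq0 => /eqP ->.
by rewrite scalerN scalerA mulVf// scale1r.
Qed.

(** A cone is the intersection of the total cones above it: adjoin [-x] first,
    so that [-x] is not in the lineality space. *)
Lemma total_cone_separation C x : is_cone C -> ~ C x ->
  exists K, [/\ total_cone K, C `<=` K & ~ K x].
Proof.
move=> [C0 CD CZ] Cx.
pose C' := [set z | exists k (t : R), [/\ C k, 0 <= t & z = k - t *: x]].
have C'c : is_cone C'.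
  split.
  - by exists 0, 0; rewrite scale0r subr0.
  - move=> _ _ [k [t [Kk t0 ->]]] [k' [t' [Kk' t'0 ->]]].
    exists (k + k'), (t + t'); split; [exact: CD|exact: addr_ge0|].
    by rewrite scalerDl opprD addrACA.
  - move=> a _ a0 [k [t [Kk t0 ->]]]; exists (a *: k), (a * t).
    by split; [exact: CZ|exact: mulr_ge0|rewrite scalerBr scalerA].
have [K [Kt CK Klin]] := total_cone_extension C'c.
exists K; split => //.
  by move=> z Cz; apply: CK; exists z, 0; rewrite scale0r subr0.
move=> Kx; have [] // := Klin x Kx.
  by apply: CK; exists 0, 1; rewrite scale1r sub0r.
move=> k [t [Ck t0 xE]]; apply: Cx.
have t1 : 1 + t != 0 by rewrite gt_eqF// ltr_wpDr.
have -> : x = (1 + t)^-1 *: k.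
  have -> : k = (1 + t) *: x by rewrite scalerDl scale1r {1}xE subrK.
  by rewrite scalerA mulVf// scale1r.
by apply: CZ => //; rewrite invr_ge0 addr_ge0.
Qed.

End Cones.

(** * Lattice cones are finite intersections of total cones *)

Section LatticeCone.
Context {R : realType} {n : nat}.
Variables (C : set 'rV[R]_n) (Cc : is_cone C).
Implicit Types x y z : 'rV[R]_n.

(** A supremum of [x] and [0]; suprema are unique only up to the lineality
    space of [C]. *)
Definition pospart (x s : 'rV[R]_n) :=
  [/\ C (s - x), C s & forall u, C (u - x) -> C u -> C (u - s)].

(** For [x] and [y] in [C], the vector [0] is an infimum of [x] and [y]; no
    infimum has to be chosen. *)
Definition disj (x y : 'rV[R]_n) := forall z, C (x - z) -> C (y - z) -> C (- z).

Let C0 : C 0. Proof. by case: Cc. Qed.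
Let CD x y : C x -> C y -> C (x + y). Proof. by case: Cc => _ + _; apply. Qed.
Let CZ (a : R) x : 0 <= a -> C x -> C (a *: x).
Proof. by case: Cc => _ _; apply. Qed.

Let CT y x z : C (y - x) -> C (z - y) -> C (z - x).
Proof. by move=> xy yz; have := CD xy yz; congr (C _); row_ring. Qed.

Lemma disj_sym x y : disj x y -> disj y x.
Proof. by move=> xy z yz xz; apply: xy. Qed.

Lemma disj_le x y y' : disj x y -> C (y - y') -> disj x y'.
Proof. by move=> xy yy' z xz yz; apply: xy => //; apply: CT yz yy'. Qed.

Lemma disj_self x : C x -> disj x x -> C (- x).
Proof. by move=> Cx; apply; rewrite subrr. Qed.

Lemma disj_scale (a : R) x y : C x -> C y -> 0 <= a -> disj x y ->
  disj x (a *: y).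
Proof.
move=> Cx Cy a0 xy; have [a1|a1] := leP a 1.
  apply: disj_le xy _; rewrite -{1}[y]scale1r -scalerBl.
  by apply: CZ => //; rewrite subr_ge0.
have {}a0 : 0 < a := lt_trans ltr01 a1.
have ai : 0 <= a^-1 by rewrite invr_ge0 ltW.
move=> z xz yz.
have : C (- (a^-1 *: z)).
  apply: xy.
    apply: (CT (y := a^-1 *: x)); first by rewrite -scalerBr; apply: CZ.
    rewrite -{1}[x]scale1r -scalerBl; apply: CZ => //.
    by rewrite subr_ge0 invf_le1// ltW.
  by have := CZ ai yz; rewrite scalerBr scalerA mulVf ?scale1r// gt_eqF.
move/(CZ (ltW a0)).
by rewrite scalerN scalerA mulfV ?scale1r// gt_eqF.
Qed.

Hypothesis C_lattice : forall x, exists s, pospart x s.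

(** If [w] lies below [x] and [y + z], then [(w^+ - y)^+] lies below [x] and
    [z], so [w^+] lies below [y]. *)
Lemma disj_add x y z : C x -> C y -> C z -> disj x y -> disj x z ->
  disj x (y + z).
Proof.
move=> Cx Cy Cz xy xz w xw yzw.
have [p [pw Cp pmin]] := C_lattice w.
have px : C (x - p) by apply: pmin.
have pyz : C (y + z - p) by apply: pmin => //; apply: CD.
have [q [qp Cq qmin]] := C_lattice (p - y).
have qN : C (- q).
  apply: xz.
    apply: (CT _ px); apply: qmin => //.
    by have := Cy; congr (C _); row_ring.
  by apply: qmin => //; have := pyz; congr (C _); row_ring.
have yp : C (y - p) by have := CD qp qN; congr (C _); row_ring.
have := CD (xy _ px yp) pw; congr (C _); row_ring.
Qed.

Lemma disj_sum (I : Type) (r : seq I) (P : pred I) (F : I -> 'rV[R]_n) x :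
  C x -> (forall i, P i -> C (F i) /\ disj x (F i)) ->
  C (\sum_(i <- r | P i) F i) /\ disj x (\sum_(i <- r | P i) F i).
Proof.
move=> Cx xF; elim/big_ind : _ => //.
- by split => // z _; rewrite sub0r.
- by move=> y z [Cy xy] [Cz xz]; split; [exact: CD|exact: disj_add].
Qed.

Lemma disj_posneg x s : pospart x s -> disj s (s - x).
Proof.
move=> [sx Cs smin] w sw sxw.
by have := smin (s - w); rewrite addrAC => /(_ sxw sw); congr (C _); row_ring.
Qed.

(** The vectors whose negative part is disjoint from [e], in other words the
    preimage of the positive cone under the quotient by the vectors disjoint
    from [e].  An upper bound [u] of the negative part stands for it, so that
    closure under sums is immediate. *)
Definition band_cone (e : 'rV[R]_n) : set 'rV[R]_n :=
  [set x | exists u, [/\ C u, C (u + x) & disj e u]].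

Lemma band_cone_cone e : C e -> is_cone (band_cone e).
Proof.
move=> Ce; split.
- exists 0; split => //; first by rewrite addr0.
  by move=> z _; rewrite sub0r.
- move=> x y [u [Cu ux eu]] [v [Cv vy ev]]; exists (u + v).
  by split; [exact: CD|rewrite addrACA; exact: CD|exact: disj_add].
- move=> a x a0 [u [Cu ux eu]]; exists (a *: u).
  by split; [exact: CZ|rewrite -scalerDr; exact: CZ|exact: disj_scale].
Qed.

Lemma sub_band_cone e : C `<=` band_cone e.
Proof.
move=> x Cx; exists 0; split => //; first by rewrite add0r.
by move=> z _; rewrite sub0r.
Qed.

Definition disj_system m (e : nat -> 'rV[R]_n) :=
  (forall i, (i < m)%N -> C (e i) /\ ~ C (- e i)) /\
  (forall i j, (i < m)%N -> (j < m)%N -> i != j -> disj (e i) (e j)).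

(** A disjoint system is linearly independent: in a vanishing combination, one
    term is dominated by a sum of multiples of the others, hence disjoint from
    itself. *)
Lemma disj_system_size m e : disj_system m e -> (m <= n)%N.
Proof.
move=> [epos edisj]; rewrite leqNgt; apply/negP => nm.
pose E : 'M[R]_(m, n) := \matrix_(i < m) e i.
have : kermx E != 0.
  rewrite -mxrank_eq0 mxrank_ker subn_eq0 -ltnNge.
  exact: leq_ltn_trans (rank_leq_col _) nm.
case/rowV0Pn => v /sub_kermxP vE v0.
have [i vi] : exists i, v 0 i != 0.
  apply/existsP; rewrite -negb_forall; apply: contra v0 => /forallP v0.
  by apply/eqP/rowP => i; rewrite mxE; apply/eqP.
have {v0 vE} [w [wE wi]] : exists w : 'I_m -> R,
    \sum_j w j *: e j = 0 /\ 0 < w i.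
  have vE' : \sum_j v 0 j *: e j = 0.
    rewrite -[RHS]vE mulmx_sum_row; apply: eq_bigr => j _.
    by congr (_ *: _); apply/rowP => l; rewrite !mxE.
  have [vp|vn|v00] := ltgtP 0 (v 0 i); last by rewrite -v00 eqxx in vi.
    by exists (v 0).
  exists (fun j => - v 0 j); rewrite oppr_gt0; split => //.
  by under eq_bigr do rewrite scaleNr; rewrite sumrN vE' oppr0.
have [Ci NCi] := epos i (ltn_ord i).
pose b := \sum_(j | j != i) `|w j| *: e j.
have [Cb ib] : C b /\ disj (e i) b.
  apply: disj_sum => // j ji; have [Cj _] := epos j (ltn_ord j).
  split; first exact: CZ.
  by apply: disj_scale => //; apply: edisj; rewrite // eq_sym.
have bi : C (b - w i *: e i).
  have -> : w i *: e i = - \sum_(j | j != i) w j *: e j.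
    by apply/eqP; rewrite -addr_eq0; move/eqP: wE; rewrite (bigD1 i).
  rewrite opprK -big_split; apply: big_ind => // j _.
  rewrite /= -scalerDl; apply: CZ; last by case: (epos j (ltn_ord j)).
  by rewrite -lerBlDr sub0r -normrN ler_norm.
apply: NCi; have ii : disj (e i) (w i *: e i) by apply: disj_le bi.
have {}ii : disj (e i) (e i).
  have : disj (e i) ((w i)^-1 *: (w i *: e i)).
    by apply: disj_scale => //; [exact/CZ/Ci/ltW|rewrite invr_ge0 ltW].
  by rewrite scalerA mulVf ?scale1r// gt_eqF.
exact: disj_self.
Qed.

Lemma disj_system_maximal :
  exists m e, disj_system m e /\ forall e', ~ disj_system m.+1 e'.
Proof.
apply: contrapT => nmax.
have all_m m : exists e, disj_system m e.
  elim: m => [|m [e em]]; first by exists (fun=> 0).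
  apply: contrapT => nex; apply: nmax; exists m, e; split => // e' e'm.
  by apply: nex; exists e'.
by have [e /disj_system_size] := all_m n.+1; rewrite ltnn.
Qed.

Lemma disj_system_extend m e p : disj_system m e -> C p -> ~ C (- p) ->
  (forall i, (i < m)%N -> disj (e i) p) ->
  disj_system m.+1 (fun j => if j == m then p else e j).
Proof.
move=> [epos edisj] Cp Np ep; split.
  move=> i; rewrite ltnS leq_eqVlt; case: eqP => //= _; exact: epos.
move=> i j; rewrite !ltnS [(i <= m)%N]leq_eqVlt [(j <= m)%N]leq_eqVlt.
case: (eqVneq i m) => [->|im]; case: (eqVneq j m) => [->|jm] //=.
- by move=> _ jlt _; apply/disj_sym/ep.
- by move=> ilt _ _; apply: ep.
- exact: edisj.
Qed.

(** If neither the positive nor the negative part of [x] is disjoint from [e i],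
    they give two disjoint nonzero positive vectors below [e i]; replacing
    [e i] by these two enlarges the system. *)
Lemma band_cone_total m e : disj_system m e ->
  (forall e', ~ disj_system m.+1 e') ->
  forall i, (i < m)%N -> total_cone (band_cone (e i)).
Proof.
move=> em nmax i im; have [epos edisj] := em.
have [Ci _] := epos i im.
split; first exact: band_cone_cone.
move=> x; have [s sx] := C_lattice x; have [Csx Cs _] := sx.
have [es|nes] := pselect (disj (e i) s).
  by right; exists s.
have [esx|nesx] := pselect (disj (e i) (s - x)).
  by left; exists (s - x); split; rewrite ?subrK.
exfalso.
have piece y : C y -> ~ disj (e i) y ->
    exists p, [/\ C p, ~ C (- p), C (e i - p) & C (y - p)].
  move=> Cy /existsNP[w /not_implyP[ew /not_implyP[yw Nw]]].
  have [p [pw Cp pmin]] := C_lattice w.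
  exists p; split => //; [|exact: pmin|exact: pmin].
  by move=> Np; apply: Nw; have := CD pw Np; congr (C _); row_ring.
have [p [Cp Np ep sp]] := piece _ Cs nes.
have [q [Cq Nq eq sq]] := piece _ Csx nesx.
have pq : disj p q.
  by apply: disj_le sq; apply: disj_sym; apply: disj_le sp;
     apply: disj_sym; exact: disj_posneg.
pose e1 j := if j == i then p else e j.
have em1 : disj_system m e1.
  split; rewrite /e1.
    by move=> j jm; case: eqP => // _; exact: epos.
  move=> j l jm lm; case: (eqVneq j i) => [->|ji].
    case: (eqVneq l i) => [//|li _].
    by apply/disj_sym/(disj_le _ ep)/edisj.
  case: (eqVneq l i) => [_ _|li jl]; last exact: edisj.
  by apply: (disj_le _ ep); apply: edisj.
apply: (nmax (fun j => if j == m then q else e1 j)).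
apply: disj_system_extend => // j jm; rewrite /e1; case: eqVneq => // ji.
by apply: (disj_le _ eq); apply: edisj.
Qed.

(** A vector in all the cones [band_cone (e i)] has a negative part disjoint
    from the whole system, hence equivalent to zero by maximality. *)
Lemma lattice_cone_inter : exists m (K : 'I_m -> set 'rV[R]_n),
  (forall i, total_cone (K i)) /\ C = [set x | forall i, K i x].
Proof.
have [m [e [em nmax]]] := disj_system_maximal.
exists m, (fun i => band_cone (e i)); split.
  by move=> i; apply: band_cone_total em nmax _ (ltn_ord i).
apply/seteqP; split => [x Cx i|x xK]; first exact: sub_band_cone.
have [q [qx Cq qmin]] := C_lattice (- x).
have [Nq|Nq] := pselect (C (- q)).
  by have := CD qx Nq; congr (C _); row_ring.
exfalso; apply: (nmax (fun j => if j == m then q else e j)).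
apply: disj_system_extend => // i im.
have [u [Cu ux eu]] := xK (Ordinal im).
by apply: (disj_le eu); apply: qmin; rewrite ?opprK.
Qed.

End LatticeCone.

(** * Conditional expectations of cone-valued random vectors *)

Section ScalarCondexp.
Context {d0 : measure_display} {Omega : measurableType d0} {R : realType}.
Variables (Q : probability Omega R) (G : set (set Omega)).
Hypotheses (hG : sigma_algebra [set: Omega] G) (hGm : G `<=` measurable).
Implicit Types x y : Omega -> R.

Definition scalar_condexp x y :=
  [/\ Q.-integrable [set: Omega] (EFin \o x),
      measurable_fun [set: g_sigma_algebraType G] y,
      Q.-integrable [set: Omega] (EFin \o y)
    & forall B, G B ->
        (\int[Q]_(w in B) (y w)%:E = \int[Q]_(w in B) (x w)%:E)%E].

Lemma is_condexpP n (X Y : Omega -> 'rV[R]_n) :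
  is_condexp Q G X Y <->
  forall i, scalar_condexp (fun w => X w ord0 i) (fun w => Y w ord0 i).
Proof.
split=> [[iX mY iY XY] i|XY]; first by split;
  [exact: iX|exact: mY|exact: iY|move=> B; exact: XY].
by split => [i|i|i|i B GB]; case: (XY i) => // _ _ _; apply.
Qed.

Lemma G_measurable (B : set (g_sigma_algebraType G)) : measurable B -> G B.
Proof. by rewrite /measurable/= sigma_algebra_id. Qed.

Lemma sub_integrable B x : measurable B ->
  Q.-integrable [set: Omega] (EFin \o x) -> Q.-integrable B (EFin \o x).
Proof. by move=> mB; apply: integrableS. Qed.

Lemma scalar_condexp_lin (a : R) x y x' y' :
  scalar_condexp x y -> scalar_condexp x' y' ->
  scalar_condexp (fun w => a * x w + x' w) (fun w => a * y w + y' w).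
Proof.
move=> [ix my iy xy] [ix' my' iy' xy'].
have ilin z z' (B : set Omega) : measurable B ->
    Q.-integrable [set: Omega] (EFin \o z) ->
    Q.-integrable [set: Omega] (EFin \o z') ->
    Q.-integrable B (fun w => (a%:E * (z w)%:E)%E) /\
    Q.-integrable B (EFin \o z').
  move=> mB iz iz'; split; last exact: sub_integrable.
  by apply: integrableZl => //; apply: sub_integrable.
split.
- by have [h1 h2] := ilin _ _ _ measurableT ix ix'; apply: integrableD h1 h2.
- by apply: measurable_funD => //; exact: measurable_funM.
- by have [h1 h2] := ilin _ _ _ measurableT iy iy'; apply: integrableD h1 h2.
move=> B GB; have mB := hGm GB.
under eq_integral do rewrite EFinD EFinM.
under [in RHS]eq_integral do rewrite EFinD EFinM.
have [h1 h2] := ilin _ _ _ mB iy iy'; have [k1 k2] := ilin _ _ _ mB ix ix'.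
rewrite (integralD mB h1 h2) (integralD mB k1 k2) xy'//.
by rewrite !integralZl ?xy//; apply: sub_integrable.
Qed.

Lemma scalar_condexp_cst (c : R) : scalar_condexp (cst c) (cst c).
Proof.
by split => //; [exact: finite_measure_integrable_cst
                |exact: finite_measure_integrable_cst].
Qed.

Lemma scalar_condexp_sum (I : Type) (r : seq I) (c : I -> R)
    (x y : I -> Omega -> R) : (forall i, scalar_condexp (x i) (y i)) ->
  scalar_condexp (fun w => \sum_(i <- r) c i * x i w)
                 (fun w => \sum_(i <- r) c i * y i w).
Proof.
move=> xy; elim: r => [|i r IH].
  under eq_fun do rewrite big_nil.
  under [X in scalar_condexp _ X]eq_fun do rewrite big_nil.
  exact: scalar_condexp_cst.
under eq_fun do rewrite big_cons.
under [X in scalar_condexp _ X]eq_fun do rewrite big_cons.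
exact: scalar_condexp_lin.
Qed.

Lemma integral_restrict (B N : set Omega) x : measurable B -> measurable N ->
  (\int[Q]_(w in B) (\1_N w * x w)%:E = \int[Q]_(w in B `&` N) (x w)%:E)%E.
Proof.
move=> mB mN; rewrite integral_mkcondr; apply: eq_integral => w _.
by rewrite patchE indicE; case: (w \in N); rewrite ?mul1r ?mul0r.
Qed.

Lemma scalar_condexp_restrict N x y : G N -> scalar_condexp x y ->
  scalar_condexp (fun w => \1_N w * x w) (fun w => \1_N w * y w).
Proof.
move=> GN [ix my iy xy]; have mN := hGm GN.
have irestr z : Q.-integrable [set: Omega] (EFin \o z) ->
    Q.-integrable [set: Omega] (EFin \o (fun w => \1_N w * z w)).
  move=> iz; have : Q.-integrable [set: Omega] ((EFin \o z) \_ N).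
    by apply: (integrable_mkcond _ mN).1; apply: sub_integrable.
  apply: eq_integrable => // w _.
  by rewrite patchE /= indicE; case: (w \in N); rewrite ?mul1r ?mul0r.
split; [exact: irestr| |exact: irestr|].
  apply: measurable_funM => //; apply: measurable_indic.
  exact: sub_sigma_algebra.
move=> B GB; have mB := hGm GB; rewrite !integral_restrict//; apply: xy.
have [_ GC GU] := hG.
have -> : B `&` N = [set: Omega] `\` \bigcup_k
    (fun k => if k is 0%N then [set: Omega] `\` B else [set: Omega] `\` N) k.
  apply/seteqP; split => [w [Bw Nw]|w [_ BN]].
    by split => // -[[|k] _] [_].
  split; apply: contrapT => nw; apply: BN; first by exists 0%N.
  by exists 1%N.
by apply/GC/GU => -[|k]; apply: GC.
Qed.

Lemma integral_ae_ge0 x B : measurable B ->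
  Q.-integrable [set: Omega] (EFin \o x) -> {ae Q, forall w, 0 <= x w} ->
  (\int[Q]_(w in B) (x w)%:E = \int[Q]_(w in B) `|(x w)%:E|)%E.
Proof.
move=> mB ix x0; have /integrableP[mx _] := sub_integrable mB ix.
apply: ae_eq_integral => //; first exact: measurableT_comp.
by apply: filterS x0 => w w0 _; rewrite gee0_abs.
Qed.

(** The conditional expectation integrates to a nonnegative number over the
    event where it is negative. *)
Lemma scalar_condexp_ge0 x y : scalar_condexp x y ->
  {ae Q, forall w, 0 <= x w} ->
  exists N, [/\ G N, Q N = 0%E & forall w, ~ N w -> 0 <= y w].
Proof.
move=> [ix my iy xy] x0; pose N := [set w | y w < 0].
have GN : G N.
  apply: G_measurable; rewrite -[N]setTI.
  have -> : N = y @^-1` `]-oo, 0%R[%classic.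
    by apply/seteqP; split => w; rewrite /= in_itv.
  exact: my.
have mN := hGm GN; exists N; split => //; last first.
  by move=> w /negP; rewrite -leNgt.
have /integrableP[myN _] := sub_integrable mN iy.
have : (\int[Q]_(w in N) `|(EFin \o y) w| = 0)%E.
  apply/eqP; rewrite eq_le integral_ge0 ?andbT//.
  have -> : (\int[Q]_(w in N) `|(EFin \o y) w| =
             - \int[Q]_(w in N) (y w)%:E)%E.
    rewrite -integralN /=; last by rewrite integrable_add_def// sub_integrable.
    by apply: eq_integral => w; rewrite inE /N/= => yw; rewrite ltr0_norm.
  by rewrite oppe_le0 xy// integral_ae_ge0// integral_ge0.
move/(ae_eq_integral_abs Q mN myN) => y0.
have : Q.-negligible N.
  apply: negligibleS y0 => w Nw /(_ Nw) /= [] yw.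
  by move: Nw; rewrite /N/= yw ltxx.
by move/(negligibleP _ mN).
Qed.

Lemma scalar_condexp_eq0 x : scalar_condexp x (cst 0) ->
  {ae Q, forall w, 0 <= x w} -> {ae Q, forall w, x w = 0}.
Proof.
move=> [ix _ _ xy] x0; have /integrableP[mx _] := ix.
have GT : G [set: Omega].
  by have [G0 GC _] := hG; rewrite -[setT]setD0; apply: GC.
have := xy _ GT; rewrite integral0 integral_ae_ge0// => /esym.
move/(ae_eq_integral_abs Q measurableT mx); apply: filterS => w.
by move=> /(_ I) [].
Qed.

End ScalarCondexp.

Section ConeCondexp.
Context {d0 : measure_display} {Omega : measurableType d0} {R : realType}.

(** The exceptional event is asked to be in [G], so that its probability under
    another measure equivalent on [G] is also zero. *)
Definition condexp_stable n (K : set 'rV[R]_n) :=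
  forall (Q : probability Omega R) (G : set (set Omega))
    (D D' : Omega -> 'rV[R]_n),
  sigma_algebra [set: Omega] G -> G `<=` measurable ->
  is_condexp Q G D D' -> {ae Q, forall w, K (D w)} ->
  exists N, [/\ G N, Q N = 0%E & forall w, ~ N w -> K (D' w)].

Section Operations.
Variables (Q : probability Omega R) (G : set (set Omega)).
Hypotheses (hG : sigma_algebra [set: Omega] G) (hGm : G `<=` measurable).

Lemma condexp_functional n (c : 'cV[R]_n) D D' : is_condexp Q G D D' ->
  scalar_condexp Q G (fun w => (D w *m c) 0 0) (fun w => (D' w *m c) 0 0).
Proof.
move=> /is_condexpP DD'.
have E (X : Omega -> 'rV[R]_n) :
    (fun w => (X w *m c) 0 0) = (fun w => \sum_i c i 0 * X w ord0 i).
  by apply/funext => w; rewrite mxE; apply: eq_bigr => i _; rewrite mulrC.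
by rewrite !E; apply: scalar_condexp_sum.
Qed.

Lemma condexp_mulmx n p (M : 'M[R]_(n, p)) D D' : is_condexp Q G D D' ->
  is_condexp Q G (fun w => D w *m M) (fun w => D' w *m M).
Proof.
move=> DD'; apply/is_condexpP => i.
have := condexp_functional (col i M) DD'.
by congr (scalar_condexp _ _ _ _); apply/funext => w;
   rewrite !mxE; apply: eq_bigr => j _; rewrite !mxE.
Qed.

Lemma condexp_restrict n N (D D' : Omega -> 'rV[R]_n) : G N ->
  is_condexp Q G D D' ->
  is_condexp Q G (fun w => \1_N w *: D w) (fun w => \1_N w *: D' w).
Proof.
move=> GN /is_condexpP DD'; apply/is_condexpP => i.
have := scalar_condexp_restrict hG hGm GN (DD' i).
by congr (scalar_condexp _ _ _ _); apply/funext => w; rewrite mxE.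
Qed.

Lemma condexpB n (X X' Y Y' : Omega -> 'rV[R]_n) :
  is_condexp Q G X X' -> is_condexp Q G Y Y' ->
  is_condexp Q G (fun w => Y w - X w) (fun w => Y' w - X' w).
Proof.
move=> /is_condexpP XX' /is_condexpP YY'; apply/is_condexpP => i.
have := scalar_condexp_lin hGm (-1) (XX' i) (YY' i).
by congr (scalar_condexp _ _ _ _); apply/funext => w;
   rewrite !mxE mulN1r addrC.
Qed.

Lemma condexp_cst n (v : 'rV[R]_n) : is_condexp Q G (cst v) (cst v).
Proof. by apply/is_condexpP => i; apply: scalar_condexp_cst. Qed.

Lemma G_setU N1 N2 : G N1 -> G N2 -> G (N1 `|` N2).
Proof.
have [_ _ GU] := hG => G1 G2.
have -> : N1 `|` N2 = \bigcup_k (fun k => if k is 0%N then N1 else N2) k.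
  apply/seteqP; split => [w [N1w|N2w]|w [[|k] _]]; [| |by left|by right].
    by exists 0%N.
  by exists 1%N.
by apply: GU => -[|k].
Qed.

Lemma measure0_setU N1 N2 : G N1 -> G N2 -> Q N1 = 0%E -> Q N2 = 0%E ->
  Q (N1 `|` N2) = 0%E.
Proof.
move=> /hGm m1 /hGm m2 q1 q2; apply/negligibleP; first exact: measurableU.
by apply: negligibleU; apply/negligibleP.
Qed.

End Operations.

(** Induction on the dimension.  With [f] nonnegative on [K] and
    [f (D') >= 0] almost surely, [D'] lies in [K] where [f (D') > 0], by
    totality; on the event [f (D') = 0] also [f (D) = 0], so that both vectors
    live in the kernel of [f], where [K] is again total. *)
Lemma total_cone_stable n (K : set 'rV[R]_n) :
  total_cone K -> condexp_stable K.
Proof.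
have [m nm] := ubnP n; elim: m n nm K => // m IH n nm K Kt Q G D D' hG hGm.
move=> DD' KD; have [G0 _ _] := hG.
have [Kall|Kn] := pselect (forall x, K x).
  by exists set0; rewrite measure0.
have [c [e [ce1 cK]]] := total_cone_functional Kt Kn.
pose f (x : 'rV[R]_n) := (x *m c) 0 0.
have fK x : 0 < f x -> K x.
  move=> fx; have [//|/cK] := Kt.2 x.
  by rewrite mulNmx mxE leNgt oppr_lt0 fx.
have DfD' := condexp_functional hGm c DD'.
have fD0 : {ae Q, forall w, 0 <= f (D w)} by apply: filterS KD => w /cK.
have [N1 [GN1 QN1 N1P]] := scalar_condexp_ge0 hG hGm DfD' fD0.
pose N2 := [set w | f (D' w) = 0].
have GN2 : G N2.
  apply: (G_measurable hG); rewrite -[N2]setTI.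
  by case: DfD' => _ mf _ _; exact: (mf measurableT [set 0]).
pose E w := \1_N2 w *: D w; pose E' w := \1_N2 w *: D' w.
have EE' : is_condexp Q G E E' by apply: condexp_restrict.
have fE'0 w : f (E' w) = 0.
  rewrite /f/E' -scalemxAl mxE indicE; case: (boolP (w \in N2)) => [|_].
    by rewrite inE /N2/= /f => ->; rewrite mulr0.
  by rewrite mul0r.
have fE0 : {ae Q, forall w, f (E w) = 0}.
  apply: (scalar_condexp_eq0 hG).
    have := condexp_functional hGm c EE'; congr (scalar_condexp _ _ _ _).
    by apply/funext.
  by apply: filterS fD0 => w w0; rewrite /f/E -scalemxAl mxE mulr_ge0//
    indicE ler0n.
(* The rows of [B] are a basis of the kernel of [f], identified with row vectors
   of smaller dimension; [pinvmx B] gives the coordinates. *)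
pose B := row_base (kermx c).
have BK x : f x = 0 -> x *m pinvmx B *m B = x.
  move=> fx; apply: mulmxKpV; rewrite eq_row_base; apply/sub_kermxP.
  by apply/matrixP => i j; rewrite !ord1 (fx : (x *m c) 0 0 = 0) mxE.
have rankB : (\rank (kermx c) < m)%N.
  rewrite mxrank_ker; suff : (0 < \rank c)%N by have := rank_leq_row c; lia.
  rewrite lt0n mxrank_eq0; apply/eqP => c0; move: ce1.
  by rewrite c0 mulmx0 mxE => /eqP; rewrite eq_sym oner_eq0.
have K0 : K 0 by case: Kt => -[].
have KE : {ae Q, forall w, K (E w *m pinvmx B *m B)}.
  apply: filterS2 KD fE0 => w KDw fEw /=; rewrite BK// /E indicE.
  by case: (w \in N2); rewrite ?scale1r ?scale0r.
have [N3 [GN3 QN3 N3P]] := IH _ rankB _ (total_cone_preimage B Kt) Q G _ _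
  hG hGm (condexp_mulmx hGm (pinvmx B) EE') KE.
exists (N1 `|` N3); split; [exact: G_setU|exact: (measure0_setU hGm)|].
move=> w /not_orP[/N1P f0 /N3P /=]; rewrite BK// /E' indicE.
case: (boolP (w \in N2)) => [_|]; first by rewrite scale1r.
rewrite notin_setE => /eqP fn0 _; apply: fK.
by rewrite lt_neqAle eq_sym fn0.
Qed.

Lemma inter_stable n m (K : 'I_m -> set 'rV[R]_n) :
  (forall i, condexp_stable (K i)) -> condexp_stable [set x | forall i, K i x].
Proof.
move=> Ks Q G D D' hG hGm DD' KD; have [G0 _ _] := hG.
have /choice[N NP] : forall i, exists N,
    [/\ G N, Q N = 0%E & forall w, ~ N w -> K i (D' w)].
  by move=> i; apply: Ks DD' _ => //; apply: filterS KD => w.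
suff [GN QN] : G (\big[setU/set0]_i N i) /\ Q (\big[setU/set0]_i N i) = 0%E.
  exists (\big[setU/set0]_i N i); split => // w Nw i.
  have [_ _] := NP i; apply; apply: contra_not Nw => Nw.
  by rewrite (bigD1 i)//=; left.
apply: (big_ind (fun N => G N /\ Q N = 0%E)).
- by split; [exact: G0|exact: measure0].
- move=> A B [GA QA] [GB QB].
  by split; [exact: G_setU|exact: (measure0_setU hGm)].
- by move=> i _; case: (NP i).
Qed.

End ConeCondexp.

(** * Means of cone-valued random vectors *)

Section Mean.
Context {d0 : measure_display} {Omega : measurableType d0} {R : realType}.
Variable P : probability Omega R.

Definition trivial_events : set (set Omega) := [set B | B = set0 \/ B = setT].

Lemma trivial_events_sigma_algebra : sigma_algebra [set: Omega] trivial_events.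
Proof.
split; first by left.
- by move=> A [->|->]; [right; rewrite setD0|left; rewrite setDv].
move=> A AT; have [[k Ak]|nk] := pselect (exists k, A k = setT).
  by right; apply/seteqP; split => // w _; exists k; rewrite ?Ak.
left; apply/seteqP; split => // w [k _]; have [->//|Ak] := AT k.
by case: nk; exists k.
Qed.

Lemma trivial_events_measurable : trivial_events `<=` measurable.
Proof. by move=> A [->|->]. Qed.

(** The integral of a random vector, as its conditional expectation on the
    trivial events. *)
Lemma mean_exists n (D : Omega -> 'rV[R]_n) : vintegrable P D ->
  exists m, is_condexp P trivial_events D (cst m).
Proof.
move=> iD; exists (\row_i fine (\int[P]_w (D w ord0 i)%:E)).
split => //.
- by move=> i; exact: finite_measure_integrable_cst.
- move=> i B [->|->]; first by rewrite !integral_set0.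
  have -> : (fun w =>
      (cst (\row_i fine (\int[P]_w (D w ord0 i)%:E)) w ord0 i)%:E) =
      cst (\int[P]_w (D w ord0 i)%:E)%E :> (Omega -> \bar R).
    apply/funext => w /=; rewrite mxE fineK//.
    exact: integrable_fin_num.
  by rewrite integral_cst// [X in (_ * X)%E]probability_setT mule1.
Qed.

(** The mean stays in an arbitrary convex cone: a mean outside the cone is
    separated from it by a total cone. *)
Lemma mean_in_cone n (C : set 'rV[R]_n) D m : is_cone C ->
  is_condexp P trivial_events D (cst m) -> {ae P, forall w, C (D w)} -> C m.
Proof.
move=> Cc Dm CD; apply: contrapT => Cm.
have [K [Kt CK Km]] := total_cone_separation Cc Cm.
have KD : {ae P, forall w, K (D w)} by apply: filterS CD => w /CK.
have [N [_ PN NP]] := total_cone_stable Kt trivial_events_sigma_algebra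
  trivial_events_measurable Dm KD.
have NT : N = setT by apply/seteqP; split => // w _; apply: contrapT => /NP.
by move: PN; rewrite NT probability_setT => /eqP; rewrite onee_eq0.
Qed.

End Mean.

(** * Suprema of random vectors *)

Section Supremum.
Context {d0 : measure_display} {Omega : measurableType d0} {R : realType}.
Context {n : nat}.
Variables (P : probability Omega R) (G : set (set Omega)).
Variable le : 'rV[R]_n -> 'rV[R]_n -> Prop.
Hypothesis Cc : is_cone (ordering_cone le).

Lemma L1_cst v : L1 P G (cst v : Omega -> 'rV[R]_n).
Proof. by split => // i; apply: finite_measure_integrable_cst. Qed.

Lemma L1B (X Y : Omega -> 'rV[R]_n) : L1 P G X -> L1 P G Y ->
  L1 P G (fun w => Y w - X w).
Proof.
move=> [mX iX] [mY iY]; split => i.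
  have -> : (fun w => (Y w - X w) ord0 i) =
      (fun w => Y w ord0 i) \- (fun w => X w ord0 i).
    by apply/funext => w; rewrite !mxE.
  by apply: measurable_funB; [exact: mY|exact: mX].
have -> : (fun w => ((Y w - X w) ord0 i)%:E) =
    (fun w => (Y w ord0 i)%:E - (X w ord0 i)%:E)%E.
  by apply/funext => w; rewrite !mxE EFinB.
by apply: integrableB; [|exact: iY|exact: iX].
Qed.

Lemma rle_ae (X Y : Omega -> 'rV[R]_n) : L1 P G X -> L1 P G Y ->
  {ae P, forall w, ordering_cone le (Y w - X w)} -> rle P le G X Y.
Proof. by move=> LX LY XY; split => //; exact: L1B. Qed.

(** The supremum of two constants is a random vector, but its mean is a
    supremum in the deterministic order. *)
Lemma vsup_pospart (I : Type) (i j : I) : i <> j ->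
  (forall X : I -> Omega -> 'rV[R]_n, (forall k, L1 P G (X k)) ->
     exists V, is_vsup P le G X V) ->
  forall x, exists s, pospart (ordering_cone le) x s.
Proof.
move=> ij hsup x; have [C0 _ _] := Cc.
have [|V [LV Vub Vmin]] :=
    hsup (fun k => if `[< k = i >] then cst x else cst 0).
  by move=> k; case: ifP => _; exact: L1_cst.
have [s Vs] := mean_exists LV.2.
have cstm (v : 'rV[R]_n) : 
    is_condexp P trivial_events (cst v : Omega -> _) (cst v).
  exact: condexp_cst.
have ub v k : (if `[< k = i >] then cst x else cst 0 : Omega -> _) = cst v ->
    ordering_cone le (s - v).
  move=> kv.
  have sv : is_condexp P trivial_events (fun w => V w - v) (cst (s - v)).
      exact: (condexpB (@trivial_events_measurable _ _) (cstm v) Vs).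
    apply: (mean_in_cone Cc sv).
  by have [_] := Vub k; rewrite kv.
exists s; split.
- by apply: (ub x i); case: asboolP.
- by rewrite -[s]subr0; apply: (ub 0 j); case: asboolP => // /esym.
move=> u ux u0.
have us : is_condexp P trivial_events (fun w => u - V w) (cst (u - s)).
  exact: (condexpB (@trivial_events_measurable _ _) Vs (cstm u)).
apply: (mean_in_cone Cc us).
have [||_ //] := Vmin (cst u); first exact: L1_cst.
move=> k; case: asboolP => _; apply: rle_ae; try exact: L1_cst.
  by apply: aeW.
by apply: aeW => w /=; rewrite subr0.
Qed.

End Supremum.

(** The difference between a family and its supremum lies in a cone that
    conditional expectations preserve.  With two distinct indices, the existence
    of suprema forces the ordering cone to be a lattice cone, and it is itself
    preserved.  With one index, a supremum is equivalent to the only member of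
    the family, and the lineality space of the ordering cone is enough. *)
Lemma vsup_stable_cone {d0 : measure_display} {Omega : measurableType d0}
    {R : realType} {n : nat} (P : probability Omega R) (G0 : set (set Omega))
    (le : 'rV[R]_n -> 'rV[R]_n -> Prop) (I : Type) :
  is_cone (ordering_cone le) ->
  (forall X : I -> Omega -> 'rV[R]_n, (forall k, L1 P G0 (X k)) ->
     exists V, is_vsup P le G0 X V) ->
  exists K : set 'rV[R]_n,
    [/\ is_cone K, K `<=` ordering_cone le,
        @condexp_stable _ Omega _ _ K
      & forall G (X : I -> Omega -> 'rV[R]_n) V,
          (forall k, L1 P G (X k)) -> is_vsup P le G X V ->
          forall k, {ae P, forall w, K (V w - X k w)}].
Proof.
move=> Cc hsup.
have [[i [j ij]]|nij] := pselect (exists i j : I, i <> j).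
  have Clat := vsup_pospart Cc ij hsup.
  have [m [K [Kt CK]]] := lattice_cone_inter Cc Clat.
  exists (ordering_cone le); split => //.
    by rewrite CK; apply: inter_stable => k; apply: total_cone_stable.
  by move=> G X V _ [_ Vub _] k; case: (Vub k).
have [K0 [K0t CK0 K0lin]] := total_cone_extension Cc.
pose K (b : 'I_2) := if b == ord0 then K0 else [set x | K0 (- x)].
have Kt b : total_cone (K b).
  rewrite /K; case: ifP => // _; split; first by apply: cone_opp; case: K0t.
  by move=> x; rewrite /=; case: K0t => _; apply.
(* [K0] and its opposite meet in the lineality space of the ordering cone. *)
exists [set x | forall b, K b x]; split.
- by apply: cone_inter => b; case: (Kt b).
- move=> x xK; apply: K0lin; first exact: (xK ord0).
  exact: (xK ord_max).
- by apply: inter_stable => b; apply: total_cone_stable.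
move=> G X V LX [LV Vub Vmin] k.
have VX : {ae P, forall w, ordering_cone le (X k w - V w)}.
  have [|//_ //] := Vmin (X k) (LX k).
  move=> l; have -> : l = k.
    by apply: contrapT => lk; apply: nij; exists l, k.
  apply: rle_ae => //; apply: aeW => w /=; rewrite subrr.
  by case: Cc.
have XV : {ae P, forall w, ordering_cone le (V w - X k w)} by case: (Vub k).
apply: filterS2 VX XV => w /CK0 h1 /CK0 h2 b; rewrite /K.
by case: ifP => //= _; rewrite opprB.
Qed.

(** * Conditional expectations under an absolutely continuous model *)

Section Model.
Context {d0 : measure_display} {Omega : measurableType d0} {R : realType}.
Context {n T : nat}.
Variables (P Q : probability Omega R) (Ft : nat -> set (set Omega)).
Hypotheses (hFt : filtration T Ft) (hQP : Q `<< P).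
Hypothesis hE : condexp_well_defined n T Ft P Q.

Let sigF t : (t <= T)%N -> sigma_algebra [set: Omega] (Ft t).
Proof. by case: hFt => + _ _; apply. Qed.

Let subF t : (t <= T)%N -> Ft t `<=` measurable.
Proof. by case: hFt => _ + _; apply. Qed.

Lemma ae_dominated (A : set Omega) : {ae P, forall w, A w} ->
  {ae Q, forall w, A w}.
Proof.
move=> [N [mN PN AN]]; exists N; split => //.
by have /null_content_dominatesP := hQP; apply.
Qed.

(** Uniqueness of conditional expectations up to [P]-null sets makes [P] and [Q]
    equivalent on the observable events: the indicator of a [Q]-null event is a
    conditional expectation of [0]. *)
Lemma observable_null t N : (0 < n)%N -> (t <= T)%N -> Ft t N ->
  Q N = 0%E -> P N = 0%E.
Proof.
move=> n0 tT FN QN; have mN := subF tT FN.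
have LX : L1 P (Ft t) (cst 0 : Omega -> 'rV[R]_n) by exact: L1_cst.
have [_ uniq] := hE (leqnn t) tT LX.
have h0 : is_condexp Q (Ft t) (cst 0) (cst 0 : Omega -> 'rV[R]_n).
  exact: condexp_cst.
have h1 : is_condexp Q (Ft t) (cst 0)
    (fun w => \1_N w *: const_mx 1 : 'rV[R]_n).
  have [_ mY iY _] := condexp_restrict (sigF tT) (subF tT) FN
    (condexp_cst Q (Ft t) (const_mx 1 : 'rV[R]_n)).
  split => //; first by move=> i; exact: finite_measure_integrable_cst.
  move=> i B FB; have mB := subF tT FB.
  under eq_integral do rewrite !mxE.
  under [RHS]eq_integral do rewrite mxE.
  rewrite integral0 (integral_restrict _ (cst 1))//.
  have mBN : measurable (B `&` N) by exact: measurableI.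
  transitivity (1 * Q (B `&` N))%E; first exact: (integral_cst Q mBN 1%E).
  by rewrite mul1e; apply: subset_measure0 QN.
have [M [mM PM]] := uniq _ _ h0 h1 => NM.
apply: (subset_measure0 (B := M)) => // w Nw; apply: NM => /=.
move=> /rowP/(_ (Ordinal n0)); rewrite !mxE indicE mem_set// mul1r.
by move/eqP; rewrite eq_sym oner_eq0.
Qed.

Lemma condexpP t s X : (t <= s)%N -> (s <= T)%N -> L1 P (Ft s) X ->
  is_condexp Q (Ft t) X (condexp Q (Ft t) X : Omega -> 'rV[R]_n) /\
  L1 P (Ft t) (condexp Q (Ft t) X).
Proof.
move=> ts sT LX; have [[Y LY XY] uniq] := hE ts sT LX.
have XE : is_condexp Q (Ft t) X (condexp Q (Ft t) X).
  exact: (xgetPex (fun=> 0) (ex_intro [set Z | is_condexp Q (Ft t) X Z] Y XY)).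
split => //; have [_ mE iE _] := XE; split => // i.
have /integrableP[mY fY] := LY.2 i; have /integrableP[mEi _] := iE i.
apply/integrableP; split => //.
suff <- : (\int[P]_w `|(Y w ord0 i)%:E| =
    \int[P]_w `|(condexp Q (Ft t) X w ord0 i)%:E|)%E by exact: fY.
apply: ae_eq_integral => //; try exact: measurableT_comp.
by apply: filterS (uniq _ _ XE XY) => w -> _.
Qed.

Lemma condexp_id X : L1 P (Ft T) X ->
  {ae P, forall w, X w = condexp Q (Ft T) X w :> 'rV[R]_n}.
Proof.
move=> LX; have [XE _] := condexpP (leqnn T) (leqnn T) LX.
have [_ uniq] := hE (leqnn T) (leqnn T) LX.
by apply: uniq => //; case: XE => iX _ _ _; split => //; case: LX.
Qed.

(** By the tower property, the difference of the two conditional expectations at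
    time [t] is the conditional expectation of [X - condexp Q (Ft s) l]. *)
Lemma condexp_monotone (K : set 'rV[R]_n) t s (l X : Omega -> 'rV[R]_n) :
  K 0 -> @condexp_stable _ Omega _ _ K -> (t <= s)%N -> (s <= T)%N ->
  L1 P (Ft T) l -> L1 P (Ft s) X ->
  {ae P, forall w, K (X w - condexp Q (Ft s) l w)} ->
  {ae P, forall w, K (condexp Q (Ft t) X w - condexp Q (Ft t) l w)}.
Proof.
move=> K0 Kst ts sT Ll LX KX.
have [n0|n0] := posnP n.
  apply: aeW => w; move: K0; congr (K _); apply/rowP => i.
  by have := ltn_ord i; rewrite {2}n0.
have tT := leq_trans ts sT.
have [[_ _ iEs Es] _] := condexpP sT (leqnn T) Ll.
have [[il mEt iEt Et] _] := condexpP tT (leqnn T) Ll.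
have [XE _] := condexpP ts sT LX.
have tower : is_condexp Q (Ft t) (condexp Q (Ft s) l) (condexp Q (Ft t) l).
  split => // i B FB; rewrite Et// Es//.
  by case: hFt => _ _ /(_ _ _ ts sT); apply.
have [N [FN QN NP]] := Kst Q (Ft t) _ _ (sigF tT) (subF tT)
  (condexpB (subF tT) tower XE) (ae_dominated KX).
exists N; split; [exact: subF FN|exact: observable_null FN QN|].
by move=> w nK; apply: contrapT => /NP.
Qed.

End Model.

(** * Dynamic programming *)

Section DynamicProgramming.
Context {R : realType} {d m k T : nat} {d0 : measure_display}.
Context {Omega : measurableType d0} {U : ptopologicalType}.
Variables (P : probability Omega R) (Ft : nat -> set (set Omega)).
Hypothesis hFt : filtration T Ft.
Variables (Theta : set 'rV[R]_d) (Q : Theta -> probability Omega R).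
Hypothesis hQP : forall theta, Q theta `<< P.
Hypothesis hE : forall theta, condexp_well_defined d T Ft P (Q theta).
Variable le : 'rV[R]_d -> 'rV[R]_d -> Prop.
Variable vsup : nat -> (Theta -> Omega -> 'rV[R]_d) -> Omega -> 'rV[R]_d.
Hypothesis vsupP : forall t (X : Theta -> Omega -> 'rV[R]_d), (t <= T)%N ->
  (forall theta, L1 P (Ft t) (X theta)) -> is_vsup P le (Ft t) X (vsup t X).
Variable F : nat -> 'rV[R]_m -> U -> 'rV[R]_k -> 'rV[R]_m.
Variable Z : nat -> Omega -> 'rV[R]_k.
Variable adm1 : nat -> (Omega -> 'rV[R]_m) -> set (Omega -> U).
Variable ell : 'rV[R]_m -> 'rV[R]_d.

Variable K : set 'rV[R]_d.
Hypotheses (Kc : is_cone K) (Kst : @condexp_stable _ Omega _ _ K).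
Hypothesis K_vsup : forall G (X : Theta -> Omega -> 'rV[R]_d) V,
  (forall theta, L1 P G (X theta)) -> is_vsup P le G X V ->
  forall theta, {ae P, forall w, K (V w - X theta w)}.

Notation adm := (adm T F Z adm1).
Notation terminal := (terminal F Z).
Notation vsup_condexp := (vsup_condexp Ft Q vsup).
Notation bellman_rec := (bellman_rec Ft Q vsup F Z adm1 ell).

(** The order used is that of [K], which may be finer than the ordering cone:
    only [K] is known to be preserved by conditional expectations. *)
Definition dominates t (X l : Omega -> 'rV[R]_d) :=
  L1 P (Ft t) X /\
  forall theta, {ae P, forall w, K (X w - condexp (Q theta) (Ft t) l w)}.

Lemma dominates_terminal l : L1 P (Ft T) l -> dominates T l l.
Proof.
move=> Ll; split => // theta.
apply: filterS (condexp_id (hE theta) Ll) => w <-.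
by rewrite subrr; case: Kc.
Qed.

Lemma dominates_step t X l : (t < T)%N -> L1 P (Ft T) l ->
  dominates t.+1 X l -> dominates t (vsup_condexp t X) l.
Proof.
move=> tT Ll [LX Xl].
have LE theta := (condexpP (hE theta) (leqnSn t) tT LX).2.
have V := vsupP (ltnW tT) LE.
split=> [|theta]; first by case: V.
have := condexp_monotone hFt (hQP theta) (hE theta) _ Kst
  (leqnSn t) tT Ll LX (Xl theta).
case: Kc => K0 KD _ /(_ K0) h1.
have h2 := K_vsup LE V theta. 
apply: filterS2 h2 h1 => w VE El.
by have := KD _ _ VE El; rewrite addrA subrK.
Qed.

Lemma bellman_rec_dominates N t S : (t + N = T)%N ->
  (forall phi, adm t S phi -> L1 P (Ft T) (ell \o terminal t S phi)) ->
  forall X, bellman_rec N t S X ->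
  exists2 phi, adm t S phi & dominates t X (ell \o terminal t S phi).
Proof.
elim: N t S => [|N IH] t S; rewrite ?addn0 => tN Lell X /=.
  move=> ->; exists [::] => //=; rewrite tN.
  by apply: dominates_terminal; apply: (Lell [::]).
move=> [u [Y [Su BY ->]]].
have tT : (t < T)%N by lia.
have [|phi' phi'P|phi phiP Yphi] := IH t.+1 (next_state F Z t S u) _ _ Y BY.
- lia.
- by apply: (Lell (u :: phi')); split.
- exists (u :: phi); first by split.
  by apply: dominates_step => //; apply: (Lell (u :: phi)); split.
Qed.

Lemma control_dominated N t S : (t + N = T)%N ->
  (forall phi, adm t S phi -> L1 P (Ft T) (ell \o terminal t S phi)) ->
  forall phi, adm t S phi ->
  exists2 X, bellman_rec N t S X & dominates t X (ell \o terminal t S phi).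
Proof.
elim: N t S => [|N IH] t S; rewrite ?addn0 => tN Lell phi /=.
  case: phi => [_|u phi /= []]; last by rewrite tN ltnn.
  by exists (ell \o S) => //; rewrite tN; apply: dominates_terminal;
     apply: (Lell [::]).
case: phi => [tT|u phi /= [tT Su phiP]]; first by
  exfalso; move: tN; rewrite /= in tT; lia.
have [|phi' phi'P|X BX Xphi] := IH t.+1 (next_state F Z t S u) _ _ phi phiP.
- lia.
- by apply: (Lell (u :: phi')); split.
- exists (vsup_condexp t X); first by exists u, X.
  by apply: dominates_step => //; apply: (Lell (u :: phi)); split.
Qed.

Lemma vsup_le_dominates t X l : is_cone (ordering_cone le) ->
  K `<=` ordering_cone le -> (t <= T)%N ->
  L1 P (Ft T) l -> dominates t X l -> rle P le (Ft t) (vsup_condexp t l) X.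
Proof.
move=> Cc KC tT Ll [LX Xl].
have LE theta := (condexpP (hE theta) tT (leqnn T) Ll).2.
have [_ _ +] := vsupP tT LE; apply => // theta.
by apply: rle_ae => //; apply: filterS (Xl theta) => w /KC.
Qed.

End DynamicProgramming.

Theorem theorem3p3 (R : realType) (d m k T : nat)
  (d0 : measure_display) (Omega : measurableType d0)
  (P : probability Omega R)
  (Ft : nat -> set (set Omega)) (hFt : filtration T Ft)
  (Theta : set 'rV[R]_d) (hTheta : finite_set Theta) (hTheta0 : Theta !=set0)
  (Q : Theta -> probability Omega R)
  (hQP : forall theta, Q theta `<< P)
  (hE : forall theta, condexp_well_defined d T Ft P (Q theta))
  (le : 'rV[R]_d -> 'rV[R]_d -> Prop) (hle : vector_preorder le)
  (hsup : forall (t : nat) (X : Theta -> Omega -> 'rV[R]_d), (t <= T)%N ->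
     (forall theta, L1 P (Ft t) (X theta)) ->
     exists V, is_vsup P le (Ft t) X V)
  (vsup : nat -> (Theta -> Omega -> 'rV[R]_d) -> Omega -> 'rV[R]_d)
  (hvsup : forall (t : nat) (X : Theta -> Omega -> 'rV[R]_d), (t <= T)%N ->
     (forall theta, L1 P (Ft t) (X theta)) ->
     (exists V, is_vsup P le (Ft t) X V) -> is_vsup P le (Ft t) X (vsup t X))
  (SS : set 'rV[R]_m)
  (U : ptopologicalType) (A : set U) (hA : compact A)
  (F : nat -> 'rV[R]_m -> U -> 'rV[R]_k -> 'rV[R]_m)
  (hF : forall t, (t < T)%N -> measurable_dynamics SS A (F t))
  (Z : nat -> Omega -> 'rV[R]_k)
  (hZ : forall t, (t <= T)%N -> rvec measurable (Z t))
  (adm1 : nat -> (Omega -> 'rV[R]_m) -> set (Omega -> U))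
  (hadmA : forall t S u, (t < T)%N -> is_state Ft SS t S -> adm1 t S u ->
     forall w, A (u w))
  (hstate : forall t S u, (t < T)%N -> is_state Ft SS t S -> adm1 t S u ->
     is_state Ft SS t.+1 (next_state F Z t S u))
  (ell : 'rV[R]_m -> 'rV[R]_d) :
  forall (t : nat) (S : Omega -> 'rV[R]_m), (t < T)%N ->
    is_state Ft SS t S ->
    (forall phi, adm T F Z adm1 t S phi ->
       L1 P (Ft T) (ell \o terminal F Z t S phi)) ->
    set_le_lower P le (Ft t)
      (value T Ft Q vsup F Z adm1 ell t S) (bellman T Ft Q vsup F Z adm1 ell t S)
    /\
    set_le_upper P le (Ft t)
      (value T Ft Q vsup F Z adm1 ell t S) (bellman T Ft Q vsup F Z adm1 ell t S).
Proof.
move=> t S tT _ Lell; have Cc := vector_preorder_cone hle.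
have vsupP s X : (s <= T)%N -> (forall theta, L1 P (Ft s) (X theta)) ->
    is_vsup P le (Ft s) X (vsup s X).
  by move=> sT LX; apply: hvsup => //; apply: hsup.
(* Any time would do here: only suprema of constants are used. *)
have [K [Kc KC Kst K_vsup]] :=
  vsup_stable_cone Cc (fun X => @hsup 0%N X (leq0n T)).
have tN : (t + (T - t) = T)%N by rewrite subnKC// ltnW.
rewrite /set_le_lower /set_le_upper /value tT /bellman; split.
  move=> X BX.
  have [phi phiP Xphi] :=
    bellman_rec_dominates hFt hQP hE vsupP Kc Kst K_vsup tN Lell BX.
  have VX := vsup_le_dominates hE vsupP Cc KC (ltnW tT) (Lell _ phiP) Xphi.
  exists (vsup_condexp Ft Q vsup t (ell \o terminal F Z t S phi)).
    by exists phi.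
  by eexists; first exact: VX; apply/funext => w /=; rewrite addrC subrK.
move=> _ [phi phiP <-].
have [X BX Xphi] :=
  control_dominated hFt hQP hE vsupP Kc Kst K_vsup tN Lell phiP.
have VX := vsup_le_dominates hE vsupP Cc KC (ltnW tT) (Lell _ phiP) Xphi.
exists X => //.
by eexists; first exact: VX; apply/funext => w /=; rewrite subKr.
Qed.
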